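(* Keep the per-unit information fixed and let $n\to\infty$, with fixed (frequentist-frame) primary parameters $\theta^\star=\theta^\star_n$ and nuisance parameters $\nu^\star=(\nu_1^\star,\dots,\nu_n^\star)\in\mathcal V^n$. Suppose Assumptions 1, 2, 3 and 4 hold. Writing $\nu^\star_{n,-i}=(\nu_1^\star,\dots,\nu_{i-1}^\star,\nu_{i+1}^\star,\dots,\nu_n^\star)$ and $G(\nu^\star_{n,-i}):=\frac{1}{n-1}\sum_{j\ne i}\delta_{\nu_j^\star}$, assume $$\max_{i=1,\dots,n}\mathbb E_{\nu^\star_{n,-i}}\Big[\mathfrak D_{\mathrm{BL}}\big(G_\Pi[U_1,\dots,U_{i-1},U_{i+1},\dots,U_n],\,G(\nu^\star_{n,-i})\big)\Big]\to0\quad\text{as }n\to\infty.$$ Then $P_1,\dots,P_n$ are asymptotic compound p-values: $$\limsup_{n\to\infty}\sup_{\alpha\in[0,1]}\Big(\frac1n\sum_{i\in\mathcal H_0}\mathbb P_{\nu^\star,\theta^\star}(P_i\le\alpha)-\alpha\Big)_+\le0.$$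
   Context: Setup: for units $i=1,\dots,n$, the data of unit $i$ are summarized by $T_i\in\mathbb R$ and $U_i\in\mathcal U$. Unit $i$ has a primary parameter $\theta_i$ and nuisance parameter $\nu_i\in\mathcal V$. Conditionally on parameters, the pairs $(T_i,U_i)$ are independent, with law depending only on $(\theta_i,\nu_i)$ through a common kernel, and the law of $U_i$ depends only on $\nu_i$. The hierarchical model used for inference posits $\nu_i\mid G$ i.i.d. $G$, $G\sim\Pi$. A null value $\theta_0$ is fixed, $\mathcal H_0=\{i:\theta_i^\star=\theta_0\}$. $P_i:=\mathfrak P_i(T_i,(U_1,\dots,U_n);\Pi)$ with $\mathfrak P_i(t,(u_1,\dots,u_n);\Pi):=\mathbb P_\Pi(|T_i|\ge|t|\mid U_1=u_1,\dots,U_n=u_n)$ under the joint hierarchical law with $\theta_i=\theta_0$. $P^{\mathrm{or}}(t,u,\nu):=\mathbb P(|T_i|\ge|t|\mid U_i=u,\nu_i=\nu)$ under $\theta_i=\theta_0$. Posterior mean from $m$ units: $G_\Pi[u_1,\dots,u_m](A):=\mathbb E_\Pi[G(A)\mid U_1=u_1,\dots,U_m=u_m]$. $\mathfrak D_{\mathrm{BL}}(G,G'):=\sup\{|\int\psi\,dG-\int\psi\,dG'|:\|\psi\|_\infty\le1,\ \psi\text{ 1-Lipschitz}\}$. $\mathbb P_{\nu^\star,\theta^\star}$ and $\mathbb E_{\nu^\star_{n,-i}}$ denote probability/expectation with parameters fixed and only data random ($\mathbb E_{\nu^\star_{n,-i}}$ over $(U_j)_{j\ne i}$). Assumption 1: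 for all $\nu,u$, the conditional law of $T_i$ given $\nu_i=\nu,U_i=u$ (under $\theta_i=\theta_0$) is absolutely continuous w.r.t. Lebesgue measure. Assumption 2: $\mathcal V$ is a compact metric space with metric $d$. Assumption 3: the family $\nu\mapsto P^{\mathrm{or}}(t,u,\nu)$, indexed by $t\in\mathbb R,u\in\mathcal U$, is uniformly equicontinuous on $\mathcal V$. Assumption 4: the family $\{\mathbb P(U_i\in\cdot\mid\nu_i=\nu):\nu\in\mathcal V\}$ is tight, all its members have densities $p(u\mid\nu)$ w.r.t. a measure $\lambda$ on $\mathcal U$, and for every compact $C\subset\mathcal U$, $\lambda(C)<\infty$ and $\{\nu\mapsto p(u\mid\nu):u\in C\}$ is uniformly bounded and equicontinuous. *)

(* Defs.v *)
From HB Require Import structures.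
From mathcomp Require Import all_boot all_order all_algebra.
From mathcomp Require Import all_classical all_reals all_analysis.

Set Implicit Arguments.
Unset Strict Implicit.
Unset Printing Implicit Defensive.

Import Order.TTheory GRing.Theory Num.Theory.
Local Open Scope classical_set_scope.
Local Open Scope ring_scope.

(** Pointed metric spaces (pointedness is needed by MathComp-Analysis'
    measurable types; the nuisance space is nonempty as soon as n >= 1). *)
#[short(type="pmetricType")]
HB.structure Definition PMetric (K : numDomainType) :=
  { M of Pointed M & Metric K M }.

Notation borel T := (g_sigma_algebraType (@open T)).

Section model.
Context {R : realType} {V : pmetricType R} {U : ptopologicalType} {Theta : Type}.

Local Notation Vb := (borel V).
Local Notation Ub := (borel U).

Definition Ulaw (kern : Theta -> V -> probability (R * Ub)%type R)
  (th : Theta) (nu : V) (A : set U) : \bar R :=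
  kern th nu (setT `*` A).

(** oracle p-value function P^or(t,u,nu) = P(|T| >= |t| | U = u, nu),
    where condT nu u is the conditional law of T_i given nu_i = nu,
    U_i = u under theta_i = theta_0 *)
Definition Por (condT : V -> U -> probability R R) (t : R) (u : U) (nu : V)
  : \bar R := condT nu u [set x : R | `|t| <= `|x|].

Definition mG (p : U -> V -> R) (G : pprobability Vb R) (u : U) : \bar R :=
  (\int[G]_(nu in [set: Vb]) (p u nu)%:E)%E.

Definition likG (p : U -> V -> R) (G : pprobability Vb R) (us : seq U)
  : \bar R := (\prod_(u <- us) mG p G u)%E.

(** posterior mean from units us: f |-> integral of f against G_Pi[us],
    i.e. E_Pi[ int f dG | U = us ] (Bayes formula) *)
Definition postmean (Pi : probability (pprobability Vb R) R)
  (p : U -> V -> R) (us : seq U) (f : V -> R) : R :=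
  fine (\int[Pi]_(G in [set: pprobability Vb R])
          ((\int[G]_(nu in [set: Vb]) (f nu)%:E) * likG p G us))%E /
  fine (\int[Pi]_(G in [set: pprobability Vb R]) likG p G us)%E.

Definition GPi (Pi : probability (pprobability Vb R) R)
  (p : U -> V -> R) (us : seq U) (A : set V) : R :=
  postmean Pi p us (fun nu => (\1_A nu : R)).

Definition BL1 (psi : V -> R) : Prop :=
  (forall x, `|psi x| <= 1) /\
  (forall x y, `|psi x - psi y| <= mdist x y).

Definition DBL_post_emp (Pi : probability (pprobability Vb R) R)
  (p : U -> V -> R) (us : seq U) (nus : seq V) : \bar R :=
  ereal_sup [set (`| postmean Pi p us psi
                     - (size nus)%:R^-1 * \sum_(nu <- nus) psi nu |)%:E
            | psi in BL1].

(** frak P_i(t, (u_1,...,u_n); Pi) = P_Pi(|T_i| >= |t| | U = us) under the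
    hierarchical model with theta_i = theta_0 (Bayes formula). *)
Definition Pfrak (Pi : probability (pprobability Vb R) R)
  (p : U -> V -> R) (condT : V -> U -> probability R R)
  (i : nat) (t : R) (us : seq U) : R :=
  let ui := nth point us i in
  fine (\int[Pi]_(G in [set: pprobability Vb R])
     ((\int[G]_(nu in [set: Vb]) (Por condT t ui nu * (p ui nu)%:E)) *
      \prod_(j < size us | j != i :> nat) mG p G (nth point us j)))%E /
  fine (\int[Pi]_(G in [set: pprobability Vb R]) likG p G us)%E.

End model.

Fixpoint iprod_int {d} {X : measurableType d} {R : realType}
  (ms : seq (probability X R)) (f : seq X -> \bar R) : \bar R :=
  match ms with
  | [::] => f [::]
  | m :: ms' => (\int[m]_(x in [set: X]) iprod_int ms' (fun xs => f (x :: xs)))%E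
  end.

(* Main.v *)
(** Leaving out unit [i], the p-value [P_i] is the ratio of the integrals of
    [P^or(t,u,.) p(u|.)] and [p(u|.)] against the posterior mean of [G] given
    the other units.  Replacing that posterior mean by the empirical measure of
    [nu_1, ..., nu_n] turns [P_i] into the conditional p-value under the mixture
    [n^-1 sum_i P_(nu_i, theta_0)], which is super-uniform on average over the
    units.  On a compact set of [u] carrying almost all the mass, both integrands
    are uniformly equicontinuous, hence uniformly close to multiples of bounded
    Lipschitz functions, so the replacement costs little once the [D_BL] distance
    is small (Markov's inequality) and the mixture density at [u] is not small;
    the set where the mixture density is at most [eta] has mass at most
    [eta * lam C].

    Nothing makes [condT nu u A] measurable in [u], nor [Pfrak] or [D_BL]
    measurable in the data.  The integral of a nonnegative nonmeasurable function
    is its lower integral (a supremum over simple functions below it), for which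
    only one-sided additivity is available. *)

Require Import Defs.
From HB Require Import structures.
From mathcomp Require Import all_boot all_order all_algebra.
From mathcomp Require Import all_classical all_reals all_analysis.
From mathcomp Require Import measurable_realfun zify ring lra.
Import Order.TTheory GRing.Theory Num.Theory.
Local Open Scope classical_set_scope.
Local Open Scope ring_scope.

Set Implicit Arguments.
Unset Strict Implicit.
Unset Printing Implicit Defensive.

(** * Lower integrals *)

Section lower_integral.
Local Open Scope ereal_scope.
Context d (T : measurableType d) (R : realType).
Variable mu : {measure set T -> \bar R}.
Implicit Types f g : T -> \bar R.

Import HBNNSimple.

Lemma le_lower_integral f g : (forall x, 0 <= f x) -> (forall x, f x <= g x) ->
  \int[mu]_x f x <= \int[mu]_x g x.
Proof.
move=> f0 fg; rewrite !ge0_integralTE//; last first.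
  by move=> x; exact: le_trans (f0 x) (fg x).
by apply: ereal_sup_le => _ [h hf <-]; exists h => // x; exact: le_trans (hf x) (fg x).
Qed.

(** The supremum defining the lower integral is the limit of the integrals of a sequence of simple
    functions below [f]. The pointwise supremum of that sequence is measurable, stays below [f], and
    attains the integral. *)
Lemma measurable_minorant f : (forall x, 0 <= f x) ->
  exists g : T -> \bar R, [/\ measurable_fun [set: T] g, forall x, 0 <= g x,
    forall x, g x <= f x & \int[mu]_x g x = \int[mu]_x f x].
Proof.
move=> f0.
pose S := [set \int[mu]_x (h x)%:E | h in
   [set h : {nnsfun T >-> R} | forall x, (h x)%:E <= f x]].
have fE : \int[mu]_x f x = ereal_sup S.
  rewrite ge0_integralTE//; congr ereal_sup; apply/seteqP; split => _ [h hf <-];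
    exists h => //; exact/esym/integralT_nnsfun || exact: integralT_nnsfun.
have [|u Su ucvg] := @ereal_sup_seq R S.
  apply/set0P; eexists; exists (@nnsfun0 _ T R) => //.
have /choice[h hP] n : exists h : {nnsfun T >-> R},
    (forall x, (h x)%:E <= f x) /\ \int[mu]_x (h x)%:E = u n.
  by have [h hf <-] := Su n; exists h.
pose g x := ereal_sup (range (fun n => (h n x)%:E)).
have gh n x : (h n x)%:E <= g x by apply: ereal_sup_ubound; exists n.
have gf x : g x <= f x by apply/ge_ereal_sup => _ [n _ <-]; exact: (hP n).1.
have g0 x : 0 <= g x by apply: le_trans (gh 0%N x); rewrite lee_fin.
exists g; split => //.
  have -> : g = fun x => esups (fun n => (h n x)%:E) 0%N.
    by apply/funext => x; rewrite /esups /sdrop /g; congr (ereal_sup (_ @` _));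
       apply/seteqP; split.
  by apply: measurable_fun_esups => n; exact/measurable_EFinP.
apply/eqP; rewrite eq_le le_lower_integral//= fE -(cvg_lim _ ucvg)//.
apply: lime_le; first exact: cvgP ucvg.
by apply: nearW => n; rewrite -(hP n).2; apply: le_lower_integral => // x; rewrite lee_fin.
Qed.

(** If [h] is a measurable minorant of [f + g], then the positive part of [h - g] is a minorant of
    [f]; it is measurable because [g] is. *)
Lemma lower_integralD_le f g : (forall x, 0 <= f x) -> (forall x, 0 <= g x) ->
  measurable_fun [set: T] g ->
  \int[mu]_x (f x + g x) <= \int[mu]_x f x + \int[mu]_x g x.
Proof.
move=> f0 g0 mg.
have [|h [mh h0 hfg <-]] := @measurable_minorant (fun x => f x + g x).
  by move=> x; exact: adde_ge0.
(* Truncation at 0 also covers [g x = +oo], where [h x - g x] is [-oo]. *)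
pose k x := maxe (h x - g x) 0.
have k0 x : 0 <= k x by rewrite /k le_max lexx orbT.
have mk : measurable_fun [set: T] k.
  by apply: measurable_maxe; [exact: emeasurable_funB|exact: measurable_cst].
apply: (@le_trans _ _ (\int[mu]_x (k x + g x))).
  apply: le_lower_integral => // x; rewrite /k.
  case: (g x) (g0 x) => [r| |]// _; last by rewrite addey ?leey// gt_eqF// lt_max ltNy0 orbT.
  by rewrite -leeBlDr// le_max lexx.
rewrite ge0_integralD//; apply: leeD2r; apply: le_lower_integral => // x.
rewrite /k ge_max f0 andbT.
case: (g x) (hfg x) (g0 x) => [r| |]//; last by rewrite addeNy leNye.
by rewrite leeBlDr.
Qed.

(** The direction that holds with no measurability at all: a sum of measurable minorants is a
    minorant of the sum. *)
Lemma lower_integral_sum (I : Type) (s : seq I) (f : I -> T -> \bar R) :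
  (forall i x, 0 <= f i x) ->
  \sum_(i <- s) \int[mu]_x f i x <= \int[mu]_x \sum_(i <- s) f i x.
Proof.
move=> f0; have /choice[g gP] i := measurable_minorant (f0 i).
rewrite (eq_bigr (fun i => \int[mu]_x g i x)); last by move=> i _; have [_ _ _ ->] := gP i.
rewrite -ge0_integral_sum//; last 2 first.
- by move=> i; have [] := gP i.
- by move=> i x _; have [] := gP i.
apply: le_lower_integral => x; first by apply: sume_ge0 => i _; have [] := gP i.
by apply: lee_sum => i _; have [] := gP i.
Qed.

Lemma lower_integralZl_le f (c : R) : (0 < c)%R -> (forall x, 0 <= f x) ->
  \int[mu]_x (c%:E * f x) <= c%:E * \int[mu]_x f x.
Proof.
move=> c0 f0; have c0' : (0 <= c)%R := ltW c0.
have [|h [mh h0 hf <-]] := @measurable_minorant (fun x => c%:E * f x).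
  by move=> x; rewrite mule_ge0.
have E x : h x = c%:E * (c^-1%:E * h x) by rewrite muleA -EFinM divff ?gt_eqF// mul1e.
rewrite (eq_integral _ _ (fun x _ => E x)) ge0_integralZl_EFin//; last 2 first.
- by move=> x _; rewrite mule_ge0// lee_fin invr_ge0.
- exact: measurable_funeM.
rewrite lee_pmul2l//; apply: le_lower_integral => x.
  by rewrite mule_ge0// lee_fin invr_ge0.
by rewrite muleC lee_pdivrMr// muleC.
Qed.

End lower_integral.

(** * Nested lower integrals over independent units *)

Section iprod_int_theory.
Local Open Scope ereal_scope.
Context d (X : measurableType d) (R : realType).
Implicit Types (m : probability X R) (ms : seq (probability X R)).
Implicit Types f g : seq X -> \bar R.

Lemma iprod_int_ge0 ms f : (forall xs, 0 <= f xs) -> 0 <= iprod_int ms f.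
Proof.
elim: ms f => [|m ms IH] f f0 /=; first exact: f0.
by apply: integral_ge0 => x _; apply: IH.
Qed.

Lemma le_iprod_int ms f g : (forall xs, 0 <= f xs) ->
  (forall xs, size xs = size ms -> f xs <= g xs) ->
  iprod_int ms f <= iprod_int ms g.
Proof.
elim: ms f g => [|m ms IH] f g f0 fg /=; first exact: fg.
apply: le_lower_integral => x; first exact: iprod_int_ge0.
by apply: IH => // xs sxs; apply: fg; rewrite /= sxs.
Qed.

Lemma lower_integral_cstD_le m (a : \bar R) (f : X -> \bar R) :
  0 <= a -> (forall x, 0 <= f x) ->
  \int[m]_x (a + f x) <= a + \int[m]_x f x.
Proof.
move=> a0 f0; under eq_integral do rewrite addeC.
rewrite addeC; apply: (le_trans (@lower_integralD_le _ _ _ _ f (cst a) _ _ _)) => //.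
by rewrite integral_cst// [X in _ + _ * X]probability_setT mule1.
Qed.

Lemma iprod_int_affine_le ms (a : \bar R) (c : R) f :
  0 <= a -> (0 < c)%R -> (forall xs, 0 <= f xs) ->
  iprod_int ms (fun xs => a + c%:E * f xs) <= a + c%:E * iprod_int ms f.
Proof.
move=> a0 c0; elim: ms f => [//|m ms IH] f f0 /=.
have cf0 g : (forall xs, 0 <= g xs) ->
    forall x : X, 0 <= c%:E * iprod_int ms (fun xs => g (x :: xs)).
  by move=> g0 x; apply: mule_ge0; [rewrite lee_fin ltW|exact: iprod_int_ge0].
apply: (@le_trans _ _ (\int[m]_x (a + c%:E * iprod_int ms (fun xs => f (x :: xs))))).
  apply: le_lower_integral => x; last exact: IH.
  by apply: iprod_int_ge0 => xs; rewrite adde_ge0// mule_ge0// lee_fin ltW.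
apply: (le_trans (lower_integral_cstD_le _ a0 (cf0 _ f0))).
by apply: leeD2l; apply: lower_integralZl_le => // x; exact: iprod_int_ge0.
Qed.

Lemma iprod_int_split_le ms1 m ms2 (F : X -> \bar R) (c : R) f g :
  (forall x, 0 <= F x) -> (0 < c)%R -> (forall xs, 0 <= g xs) ->
  (forall xs, 0 <= f xs) ->
  (forall xs x ys, size xs = size ms1 -> size ys = size ms2 ->
     f (xs ++ x :: ys) <= F x + c%:E * g (xs ++ ys)) ->
  iprod_int (ms1 ++ m :: ms2) f <=
  \int[m]_x F x + c%:E * iprod_int (ms1 ++ ms2) g.
Proof.
move=> F0 c0; elim: ms1 f g => [|m1 ms1 IH] f g g0 f0 fFg /=.
  (* At the distinguished coordinate the roles swap: [F x] is constant for the integrals inside, and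
     what they leave of [g] is constant in [x]. *)
  apply: (@le_trans _ _ (\int[m]_x (c%:E * iprod_int ms2 g + F x))).
    apply: le_lower_integral => x; first exact: iprod_int_ge0.
    apply: (@le_trans _ _ (iprod_int ms2 (fun ys => F x + c%:E * g ys))).
      by apply: le_iprod_int => // ys sys; exact: (fFg [::]).
    by rewrite [leRHS]addeC; exact: iprod_int_affine_le.
  rewrite [leRHS]addeC; apply: lower_integral_cstD_le => //.
  by apply: mule_ge0; [rewrite lee_fin ltW|exact: iprod_int_ge0].
apply: (@le_trans _ _ (\int[m1]_x1 (\int[m]_x F x +
    c%:E * iprod_int (ms1 ++ ms2) (fun xs => g (x1 :: xs))))).
  apply: le_lower_integral => x; first exact: iprod_int_ge0.
  apply: IH => // xs y ys sxs sys.
  by apply: (fFg (x :: xs)) => //=; rewrite sxs.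
apply: (le_trans (lower_integral_cstD_le _ _ _)).
- exact: integral_ge0.
- by move=> x; apply: mule_ge0; [rewrite lee_fin ltW|exact: iprod_int_ge0].
by apply: leeD2l; apply: lower_integralZl_le => // x; exact: iprod_int_ge0.
Qed.

End iprod_int_theory.

(** * Conditional laws without measurability *)

Section disintegration.
Local Open Scope ereal_scope.
Context d1 d2 (X : measurableType d1) (Y : measurableType d2) (R : realType).
Variables (mu : probability (X * Y)%type R) (lam : {measure set Y -> \bar R}).
Variables (k : Y -> probability X R) (q : Y -> R).
Hypothesis q0 : forall y, (0 <= q y)%R.
Hypothesis mq : measurable_fun [set: Y] q.
Hypothesis mu_rect : forall A B, measurable A -> measurable B ->
  mu (A `*` B) = \int[lam]_(y in B) (k y A * (q y)%:E).

Let f (E : set (X * Y)) y := k y (ysection E y) * (q y)%:E.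

Let f_ge0 E y : 0 <= f E y. Proof. by rewrite /f mule_ge0// lee_fin. Qed.

Let fC E y : measurable E -> f (~` E) y = (q y)%:E - f E y.
Proof.
move=> mE; rewrite /f.
have -> : ysection (~` E) y = ~` ysection E y.
  by apply/seteqP; split => x; rewrite /= !ysectionE.
rewrite probability_setC; last exact: measurable_ysection.
by rewrite muleBl ?mul1e// fin_num_adde_defr ?fin_num_measure//; exact: measurable_ysection.
Qed.

Let f_le E y : measurable E -> f E y <= (q y)%:E.
Proof.
move=> mE; rewrite -[leRHS]mul1e; apply: lee_wpmul2r; first by rewrite lee_fin.
by apply: probability_le1; exact: measurable_ysection.
Qed.

Let int_q : \int[lam]_y (q y)%:E = 1.
Proof.
rewrite -(@probability_setT _ _ _ mu) -setXTT mu_rect//.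
by apply: eq_integral => y _; rewrite probability_setT mul1e.
Qed.

(* [f E] need not be measurable, but [mu_rect] holding for a rectangle and for its
   complement forces it to coincide [lam]-almost everywhere with measurable bounds;
   this property is stable under the operations of a Dynkin system. *)
Let bracket (E : set (X * Y)) := exists lo hi : Y -> \bar R,
  [/\ measurable_fun [set: Y] lo, measurable_fun [set: Y] hi,
    forall y, 0 <= lo y <= f E y,
    forall y, f E y <= hi y <= (q y)%:E &
    mu E <= \int[lam]_y lo y /\ \int[lam]_y hi y <= mu E].

Let mqE : measurable_fun [set: Y] (fun y => (q y)%:E).
Proof. exact/measurable_EFinP. Qed.

Let int_qB (g : Y -> \bar R) : measurable_fun [set: Y] g ->
  (forall y, 0 <= g y <= (q y)%:E) ->
  \int[lam]_y ((q y)%:E - g y) = 1 - \int[lam]_y g y.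
Proof.
move=> mg g0q.
have gfin y : g y \is a fin_num.
  by have /andP[g0 gq] := g0q y; rewrite ge0_fin_numE// (le_lt_trans gq)// ltry.
have g0 y : 0 <= g y by have /andP[] := g0q y.
have qg0 y : 0 <= (q y)%:E - g y by have /andP[_ ?] := g0q y; rewrite sube_ge0// gfin.
have int_g : \int[lam]_y g y \is a fin_num.
  rewrite ge0_fin_numE; last exact: integral_ge0.
  rewrite (@le_lt_trans _ _ 1)// ?ltry// -int_q.
  by apply: ge0_le_integral => // y _; have /andP[] := g0q y.
rewrite -int_q -(addeK (\int[lam]_y ((q y)%:E - g y)) int_g) -ge0_integralD//.
  by congr (_ - _); apply: eq_integral => y _; rewrite subeK.
exact: emeasurable_funB.
Qed.

(** Passing to the complement turns [f E] into [q - f E], so the two bounds are reflected in [q] and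
    exchanged. *)
Let bracketC E : measurable E -> bracket E -> bracket (~` E).
Proof.
move=> mE [lo [hi [mlo mhi lof fhi [muE Emu]]]].
exists (fun y => (q y)%:E - hi y), (fun y => (q y)%:E - lo y); split.
- exact: emeasurable_funB.
- exact: emeasurable_funB.
- move=> y; have /andP[fh hq] := fhi y; rewrite fC// leeB// andbT sube_ge0//.
  by rewrite ge0_fin_numE ?(le_lt_trans hq) ?ltry// (le_trans (f_ge0 _ _) fh).
- move=> y; have /andP[l0 lf] := lof y; rewrite fC// leeB//=.
  by rewrite geeDl// oppe_le0.
- rewrite !int_qB//; last 2 first.
  + by move=> y; have /andP[-> lf] := lof y; exact: le_trans lf (f_le _ _).
  + by move=> y; have /andP[fh ->] := fhi y; rewrite (le_trans (f_ge0 _ _) fh).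
  by rewrite probability_setC//; split; exact: leeB.
Qed.

(** Since [f E] and its counterpart for the complement add up to [q], a measurable minorant of the
    latter yields a measurable majorant of the former. *)
Let bracket_lower E : measurable E ->
  mu E <= \int[lam]_y f E y -> mu (~` E) <= \int[lam]_y f (~` E) y -> bracket E.
Proof.
move=> mE muE muC.
have [g [mg g0 gf gE]] := measurable_minorant lam (f_ge0 E).
have [h [mh h0 hf hE]] := measurable_minorant lam (f_ge0 (~` E)).
have hq y : h y <= (q y)%:E by apply: le_trans (hf y) (f_le _ (measurableC mE)).
exists g, (fun y => (q y)%:E - h y); split => //.
- exact: emeasurable_funB.
- by move=> y; rewrite g0 gf.
- move=> y; rewrite geeDl ?oppe_le0// andbT -[in f E y](setCK E) fC; last exact: measurableC.
  exact: leeB.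
- rewrite gE; split => //; rewrite int_qB//; last by move=> y; rewrite h0 hq.
  rewrite hE -[E in leRHS]setCK probability_setC; last exact: measurableC.
  exact: leeB.
Qed.

(** The complement of a rectangle is a disjoint union of two rectangles, so superadditivity of the
    lower integral gives the bound that [bracket_lower] asks of it. *)
Let bracket_rect A B : measurable A -> measurable B -> bracket (A `*` B).
Proof.
have mu_le C D : measurable C -> measurable D ->
    mu (C `*` D) = \int[lam]_y (f (C `*` D) y).
  move=> mC mD; rewrite mu_rect// integral_mkcond; apply: eq_integral => y _.
  rewrite patchE /f; case: ifPn => yD; first by rewrite in_ysectionX.
  by rewrite notin_ysectionX// measure0 mul0e.
move=> mA mB; have mAB := measurableX mA mB.
have mAC := measurableC mA; have mBC := measurableC mB.
apply: bracket_lower => //; first by rewrite -mu_le.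
have ABC : ~` (A `*` B) = (~` A `*` B) `|` (setT `*` ~` B).
  apply/seteqP; split => [[x y]/= /not_andP[nA|nB]|[x y]/=].
  - by have [yB|yB] := pselect (B y); [left|right].
  - by right.
  - by move=> [[nA _]|[_ nB]] [].
have m1 := measurableX mAC mB; have m2 := measurableX (@measurableT _ X) mBC.
have -> : mu (~` (A `*` B)) = mu (~` A `*` B) + mu (setT `*` ~` B).
  by rewrite ABC measureU//; apply/seteqP; split => // -[x y]/= [[_ ?] [_]].
rewrite !mu_le//.
have := @lower_integral_sum _ _ _ lam bool [:: true; false]
  (fun b y => f (if b then ~` A `*` B else setT `*` ~` B) y).
rewrite !big_cons big_nil adde0 => /(_ (fun _ => f_ge0 _))/le_trans; apply.
apply: le_lower_integral => y; first by apply: sume_ge0 => i _; exact: f_ge0.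
rewrite !big_cons big_nil adde0 /f -ge0_muleDl// ABC.
rewrite -measureU; [|exact: measurable_ysection..|].
  by rewrite !ysectionE preimage_setU.
by apply/seteqP; split => // x; rewrite !ysectionE/= => -[[_ ?] [_]].
Qed.

Let bracket_bigcup (F : (set (X * Y))^nat) : (forall n, measurable (F n)) ->
  trivIset [set: nat] F -> (forall n, bracket (F n)) -> bracket (\bigcup_n F n).
Proof.
move=> mF tF /choice[lo /choice[hi H]].
have fU y : f (\bigcup_n F n) y = \sum_(n <oo) f (F n) y.
  rewrite /f ysection_bigcup measure_bigcup//=; last 2 first.
  - by move=> n _; exact: measurable_ysection.
  - exact: trivIset_ysection.
  rewrite muleC -nneseriesZl//.
  rewrite (@eq_eseriesl _ _ predT); last by move=> n; exact: in_setT.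
  by apply: eq_eseriesr => n _; rewrite muleC.
have mlo : measurable_fun [set: Y] (fun y => \sum_(n <oo) lo n y).
  by apply: ge0_emeasurable_sum => n; have [? _ l _ _] := H n => // y _ _; have /andP[] := l y.
have mhi : measurable_fun [set: Y] (fun y => \sum_(n <oo) hi n y).
  apply: ge0_emeasurable_sum => n; have [_ ? _ l _] := H n => // y _ _.
  by have /andP[fh _] := l y; exact: le_trans (f_ge0 _ _) fh.
have mU : measurable (\bigcup_n F n) by exact: bigcupT_measurable.
have muU : mu (\bigcup_n F n) = \sum_(n <oo) mu (F n).
  by rewrite measure_bigcup//; apply: eq_eseriesl => n; exact: in_setT.
have muU_lo : mu (\bigcup_n F n) <= \int[lam]_y \sum_(n <oo) lo n y.
  rewrite muU integral_nneseries//; last 2 first.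
  - by move=> n; have [] := H n.
  - by move=> n y _; have [_ _ /(_ y)/andP[]] := H n.
  by apply: lee_nneseries => // n _; have [_ _ _ _ []] := H n.
have hi_muU : \int[lam]_y \sum_(n <oo) hi n y <= mu (\bigcup_n F n).
  rewrite muU integral_nneseries//; last 2 first.
  - by move=> n; have [] := H n.
  - by move=> n y _; have [_ _ _ /(_ y)/andP[fh _] _] := H n; exact: le_trans (f_ge0 _ _) fh.
  apply: lee_nneseries => n; last by have [_ _ _ _ []] := H n.
  move=> _ _; apply: integral_ge0 => y _.
  by have [_ _ _ /(_ y)/andP[fh _] _] := H n; exact: le_trans (f_ge0 _ _) fh.
(* The sum of the upper bounds may exceed [q]; capping it keeps it above [f] and only lowers its
   integral. *)
exists (fun y => \sum_(n <oo) lo n y), (fun y => mine (\sum_(n <oo) hi n y) (q y)%:E).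
have m0 y : 0 <= mine (\sum_(n <oo) hi n y) (q y)%:E.
  rewrite le_min lee_fin q0 andbT; apply: nneseries_ge0 => n _ _.
  by have [_ _ _ /(_ y)/andP[fh _] _] := H n; exact: le_trans (f_ge0 _ _) fh.
split => //.
- exact: measurable_mine.
- move=> y; rewrite nneseries_ge0/=; last by move=> n _ _; have [_ _ /(_ y)/andP[]] := H n.
  by rewrite fU; apply: lee_nneseries => n _; have [_ _ /(_ y)/andP[]] := H n.
- move=> y; rewrite le_min ge_min lexx orbT andbT f_le// andbT fU.
  by apply: lee_nneseries => n _; have [_ _ _ /(_ y)/andP[]] := H n.
- split => //; apply: le_trans hi_muU; apply: le_lower_integral => // y.
  by rewrite ge_min lexx.
Qed.

(** Rectangles are stable under intersection and generate the product sigma-algebra, so the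
    bracketing property spreads from them to every measurable set; the lower bound then gives the
    inequality. *)
Lemma disintegration_le (E : set (X * Y)) : measurable E ->
  mu E <= \int[lam]_y (k y (ysection E y) * (q y)%:E).
Proof.
move=> mE; suff [lo [hi [_ _ lof _ [muE _]]]] : bracket E.
  by apply: le_trans muE _; apply: le_lower_integral => y; have /andP[] := lof y.
move: (mE); rewrite measurable_prod_measurableType; move: E {mE}.
apply: dynkin_induction.
- by rewrite measurable_prod_measurableType.
- move=> _ _ [A1 mA1 [A2 mA2 <-]] [B1 mB1 [B2 mB2 <-]].
  exists (A1 `&` B1); first exact: measurableI.
  exists (A2 `&` B2); first exact: measurableI.
  by rewrite setXI.
- by rewrite -setXTT; exact: bracket_rect.
- by move=> _ [A mA [B mB <-]]; exact: bracket_rect.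
- by move=> E mE; exact: bracketC.
- exact: bracket_bigcup.
Qed.

End disintegration.

(** * Super-uniformity on average over the units *)

Section compound_superuniform.
Local Open Scope ereal_scope.
Context (R : realType).

Lemma measurable_tail (s : R) : measurable [set x : R | (s <= `|x|)%R].
Proof.
have -> : [set x : R | (s <= `|x|)%R] = [set: R] `&` (@Num.norm _ R) @^-1` `[s, +oo[.
  by apply/seteqP; split => x /=; rewrite in_itv/= andbT => // -[].
exact: normr_measurable.
Qed.

(* [inf `|E|] need not be attained, but [E] is covered by the increasing tails
   [`|x| >= inf + 1/(k+1)], each contained in a tail [`|x| >= `|t|] with [t] in [E]. *)
Lemma tail_superuniform (m : {measure set R -> \bar R}) (E : set R) (a : \bar R) :
  0 <= a -> measurable E ->
  (forall t, E t -> m [set x | (`|t| <= `|x|)%R] <= a) -> m E <= a.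
Proof.
move=> a0 mE Ea.
have [->|/set0P E0] := eqVneq E set0; first by rewrite measure0.
have [[t0 Et0 t0min]|nomin] := pselect (exists2 t0, E t0 & forall t, E t -> (`|t0| <= `|t|)%R).
  apply: le_trans (Ea _ Et0); apply: le_measure; rewrite ?inE//.
  exact: measurable_tail.
pose S : set R := [set `|t|%R | t in E].
have S_inf : has_inf S.
  by split; [case: E0 => t Et; exists `|t|%R, t|exists 0%R => _ [t _ <-]].
pose A k := [set x : R | (inf S + k.+1%:R^-1 <= `|x|)%R].
have AE k : m (A k) <= a.
  have [_ [t Et <-] tS] := inf_adherent (divr_gt0 ltr01 (ltr0Sn R k)) S_inf.
  apply: le_trans (Ea _ Et); apply: le_measure; rewrite ?inE; [exact: measurable_tail..|].
  by move=> x /=; apply: le_trans; apply: ltW; rewrite mul1r in tS.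
have EA : E `<=` \bigcup_k A k.
  move=> t Et.
  have inf_lt : (inf S < `|t|)%R.
    rewrite lt_neqAle ge_inf//; last 2 first.
    - exact: S_inf.2.
    - by exists t.
    rewrite andbT; apply/eqP => infE; apply: nomin; exists t => // t' Et'.
    by rewrite -infE ge_inf//; [exact: S_inf.2|exists t'].
  rewrite -subr_gt0 in inf_lt.
  (* The gap is positive because the infimum is not attained, and this index makes [1/(k+1)] at most
     the gap. *)
  exists (Num.truncn (`|t| - inf S)^-1) => //.
  rewrite /A/= addrC -lerBrDr invf_ple ?posrE// ltW//.
  exact: truncnS_gt.
have mA k : measurable (A k) by exact: measurable_tail.
have mUA : measurable (\bigcup_k A k) by exact: bigcupT_measurable.
apply: (@le_trans _ _ (m (\bigcup_k A k))); first by apply: le_measure; rewrite ?inE.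
have ndA : nondecreasing_seq A.
  move=> i j ij; apply/subsetPset => x; rewrite /A/=; apply: le_trans.
  by rewrite lerD2l lef_pV2 ?posrE// ler_nat.
have cA := nondecreasing_cvg_mu (mu := m) mA mUA ndA.
rewrite -(cvg_lim _ cA)//; apply: lime_le; first exact: cvgP cA.
by apply: nearW => k; exact: AE.
Qed.

Context d (Y : measurableType d).
Variables (mu : nat -> probability (R * Y)%type R) (lam : {measure set Y -> \bar R}).
Variables (k : nat -> Y -> probability R R) (q : nat -> Y -> R).
Hypothesis q0 : forall i y, (0 <= q i y)%R.
Hypothesis mq : forall i, measurable_fun [set: Y] (q i).
Hypothesis mu_rect : forall i A B, measurable A -> measurable B ->
  mu i (A `*` B) = \int[lam]_(y in B) (k i y A * (q i y)%:E).

(** For fixed [y], [tail_superuniform] applies to the unnormalised mixture of the conditional laws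
    with weights [q i y]; integrating over [y] gives [n * a], as each [q i] has integral 1. *)
Lemma compound_superuniform (n : nat) (a : R) (S : set (R * Y)) : (0 <= a)%R ->
  (forall t y, S (t, y) ->
     \sum_(i < n) k i y [set x | (`|t| <= `|x|)%R] * (q i y)%:E <=
     a%:E * \sum_(i < n) (q i y)%:E) ->
  \sum_(i < n) \int[mu i]_z (\1_S z)%:E <= (n%:R * a)%:E.
Proof.
move=> a0 Sa.
have ind0 z : 0 <= (\1_S z)%:E :> \bar R by rewrite lee_fin.
have /choice[g gP] i := measurable_minorant (mu i) ind0.
(* [S] may be nonmeasurable, so it is replaced by the union of the positivity sets of its minorants:
   a single measurable subset of [S] that serves all the [mu i] at once. *)
pose Es i := [set z | 0 < g i z].
have mEs i : measurable (Es i).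
  have [mg _ _ _] := gP i; rewrite /Es -[X in measurable X]setTI.
  exact: emeasurable_fun_o_infty.
have EsS i : Es i `<=` S.
  move=> z /= gz; have [_ _ /(_ z) gS _] := gP i.
  move: (lt_le_trans gz gS); rewrite lte_fin indicE.
  by case: (boolP (z \in S)) => [/set_mem//|]; rewrite ltxx.
pose E := \bigcup_i Es i.
have mE : measurable E by exact: bigcupT_measurable.
have muE i : \int[mu i]_z (\1_S z)%:E <= mu i E.
  have [mg g0 gS <-] := gP i.
  rewrite -[E]setIT -integral_indic//.
  apply: le_lower_integral => // z; have [zE|zE] := boolP (z \in E).
    apply: le_trans (gS z) _; rewrite lee_fin !indicE zE.
    by case: (z \in S).
  rewrite indicE (negbTE zE) leNgt; apply: contra zE => gz; apply/mem_set.
  by exists i.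
apply: (@le_trans _ _ (\sum_(i < n) mu i E)); first exact: lee_sum.
apply: (@le_trans _ _ (\sum_(i < n) \int[lam]_y (k i y (ysection E y) * (q i y)%:E))).
  by apply: lee_sum => i _; apply: disintegration_le => //; exact: mu_rect.
apply: (@le_trans _ _ (\int[lam]_y \sum_(i < n) (k i y (ysection E y) * (q i y)%:E))).
  by apply: lower_integral_sum => i y; rewrite mule_ge0// lee_fin.
apply: (@le_trans _ _ (\int[lam]_y (a%:E * \sum_(i < n) (q i y)%:E))).
  apply: le_lower_integral => y.
    by apply: sume_ge0 => i _; rewrite mule_ge0// lee_fin.
  pose m : {measure set R -> \bar R} := msum (fun i => mscale (NngNum (q0 i y)) (k i y)) n.
  have mE' A : m A = \sum_(i < n) k i y A * (q i y)%:E.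
    by rewrite /m /msum/=; apply: eq_bigr => i _; rewrite /mscale/= muleC.
  rewrite -mE'; apply: tail_superuniform.
  - by rewrite mule_ge0// ?lee_fin// sume_ge0// => i _; rewrite lee_fin.
  - exact: measurable_ysection.
  - move=> t; rewrite /ysection/= => /set_mem[i _ Est]; rewrite mE'; apply: Sa.
    exact: EsS Est.
have mqE i : measurable_fun [set: Y] (fun y => (q i y)%:E) by exact/measurable_EFinP.
rewrite ge0_integralZl_EFin//; last 2 first.
- by move=> y _; apply: sume_ge0 => i _; rewrite lee_fin.
- exact: emeasurable_sum.
rewrite ge0_integral_sum//; last by move=> i y _; rewrite lee_fin.
rewrite (eq_bigr (fun=> 1)); last first.
  move=> i _; rewrite -(@probability_setT _ _ _ (mu i)) -setXTT mu_rect//.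
  by apply: eq_integral => y _; rewrite probability_setT mul1e.
by rewrite sumEFin sumr_const card_ord -EFinM mulrC.
Qed.

(** The set [S] costs [n * a], the complement of [C] costs [n * eps], and [B] costs the integral of
    the mixture density over it, at most [n * eta * lam C]. Only [S] may be nonmeasurable, so
    one-sided additivity suffices. *)
Lemma compound_level_le (n : nat) (a eps eta : R) (S : set (R * Y)) (C : set Y) :
  let B := C `&` [set y | (\sum_(i < n) q i y <= n%:R * eta)%R] in
  (0 <= a)%R -> (0 <= eta)%R -> measurable C -> lam C < +oo ->
  (eta * fine (lam C) <= eps)%R ->
  (forall i, mu i ([set: R] `*` ~` C) <= eps%:E) ->
  (forall t y, S (t, y) ->
     \sum_(i < n) k i y [set x | (`|t| <= `|x|)%R] * (q i y)%:E <=
     a%:E * \sum_(i < n) (q i y)%:E) ->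
  \sum_(i < n) \int[mu i]_z ((\1_S z)%:E +
     ((\1_([set: R] `*` ~` C) z)%:E + (\1_([set: R] `*` B) z)%:E)) <=
  (n%:R * (a + 2 * eps))%:E.
Proof.
move=> B a0 eta0 mC lamC etaC muC Sa.
have mB : measurable B.
  apply: measurableI => //.
  have -> : [set y | (\sum_(i < n) q i y <= n%:R * eta)%R] =
      [set: Y] `&` (fun y => \sum_(i < n) q i y)%R @^-1` `]-oo, (n%:R * eta)%R].
    by apply/seteqP; split => y /=; rewrite in_itv/= => // -[].
  by have := @measurable_sum _ Y R setT _ (index_enum 'I_n) (fun i => q i) (fun i => mq i); apply.
have mTC := measurableX (@measurableT _ R) (measurableC mC).
have mTB := measurableX (@measurableT _ R) mB.
have ind0 A z : 0 <= (\1_A z)%:E :> \bar R by rewrite lee_fin.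
have mind (A : set (R * Y)) : measurable A ->
    measurable_fun [set: R * Y] (fun z => (\1_A z)%:E : \bar R).
  by move=> mA; apply/measurable_EFinP; exact: measurable_indic.
have muTB i : mu i ([set: R] `*` B) = \int[lam]_(y in B) (q i y)%:E.
  rewrite mu_rect//; apply: eq_integral => y _.
  by rewrite probability_setT mul1e.
apply: (@le_trans _ _ (\sum_(i < n) (\int[mu i]_z (\1_S z)%:E +
    (eps%:E + \int[lam]_(y in B) (q i y)%:E)))).
  apply: lee_sum => i _.
  apply: (le_trans (lower_integralD_le _ _ _ _)) => //.
  - by move=> z; exact: adde_ge0.
  - by apply: emeasurable_funD; exact: mind.
  apply: leeD2l; rewrite ge0_integralD//; [|exact: mind..].
  rewrite !integral_indic// !setIT; apply: leeD; first exact: muC.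
  by rewrite -muTB.
rewrite big_split/= [X in _ + X]big_split/=.
have -> : (n%:R * (a + 2 * eps))%:E = (n%:R * a)%:E + ((n%:R * eps)%:E + (n%:R * eps)%:E).
  by rewrite -!EFinD; congr EFin; ring.
apply: leeD; first exact: compound_superuniform a0 Sa.
apply: leeD; first by rewrite sumEFin sumr_const card_ord mulr_natl.
have mqE i : measurable_fun B (fun y => (q i y)%:E).
  by apply/measurable_EFinP; exact: measurable_funTS.
rewrite -ge0_integral_sum//; last by move=> i y _; rewrite lee_fin.
apply: (@le_trans _ _ (\int[lam]_(y in B) (n%:R * eta)%:E)).
  apply: ge0_le_integral => //.
  - by move=> y _; apply: sume_ge0 => i _; rewrite lee_fin.
  - exact: emeasurable_sum.
  - by move=> y [_ /=]; rewrite sumEFin lee_fin.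
rewrite integral_cst//; apply: (@le_trans _ _ ((n%:R * eta)%:E * lam C)).
  apply: lee_wpmul2l; first by rewrite lee_fin mulr_ge0.
  by apply: le_measure; rewrite ?inE// => y [].
have lamCfin : lam C \is a fin_num by rewrite ge0_fin_numE.
by rewrite -(fineK lamCfin) -EFinM lee_fin -mulrA ler_wpM2l.
Qed.

End compound_superuniform.

(** * Bounded Lipschitz functions and posterior means *)

Section metric_regularity.
Context (R : realType) (V : pmetricType R).

(** The Heine-Cantor argument, run for all members of the family at once. *)
Lemma uniform_equicontinuous (I : Type) (A : set I) (p : I -> V -> R) :
  compact [set: V] ->
  (forall x (e : R), 0 < e -> exists2 delta : R, 0 < delta &
     forall i y, A i -> mdist x y < delta -> `|p i y - p i x| < e) ->
  forall e : R, 0 < e -> exists2 delta : R, 0 < delta &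
    forall i x y, A i -> mdist x y < delta -> `|p i x - p i y| < e.
Proof.
move=> /compact_near_coveringP cV eqp e e0.
pose P (delta : R) x := forall i y, A i -> mdist x y < delta -> `|p i x - p i y| < e.
have /cV : forall x, [set: V] x ->
    \forall x' \near x & delta \near 0^'+, P delta x'.
  move=> x _; have [d d0 pd] := eqp x _ (divr_gt0 e0 (ltr0n R 2)).
  have d20 : 0 < d / 2 by rewrite divr_gt0.
  (* With both radii halved, [x'] and any [y] close to it lie within [d] of the same centre [x]. *)
  exists (ball x (d / 2), [set t | t < d / 2]).
    by split => /=; [exact: nbhsx_ballx|exact: nbhs_right_lt].
  move=> [x' t]/= []; rewrite ballEmdist/= => xx' td i y Ai x'y.
  rewrite -(subrKA (p i x)) (le_lt_trans (ler_normD _ _))//.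
  rewrite [ltRHS]splitr ltrD//.
    by rewrite pd// (lt_trans xx')// ltr_pdivrMr// mulr_natr mulr2n ltrDl.
  rewrite distrC pd// (le_lt_trans (metric_triangle _ x' _))//.
  by rewrite [ltRHS]splitr ltrD// (lt_trans x'y).
move=> near_P.
have [delta [delta0 Pdelta]] : exists delta, 0 < delta /\ [set: V] `<=` P delta.
  apply: (@filter_ex _ (0 : R)^'+); near=> delta; split; first by near: delta; exact: nbhs_right_gt.
  by near: delta.
by exists delta => // i x y; exact: Pdelta.
Unshelve. all: by end_near. Qed.

Lemma continuous_borel_measurable (f : V -> R) :
  (forall x (e : R), 0 < e -> exists2 delta : R, 0 < delta &
     forall y, mdist x y < delta -> `|f x - f y| < e) ->
  measurable_fun [set: borel V] f.
Proof.
move=> cf; apply: (measurability _ (RGenOInfty.measurableE R)) => _ [_ [a ->] <-].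
rewrite setTI; apply: sub_sigma_algebra; rewrite openE => x /=.
rewrite in_itv/= andbT => afx.
have [d d0 fd] := cf x (f x - a) ltac:(by rewrite subr_gt0).
apply/nbhs_ballP; exists d => //= y; rewrite ballEmdist/= => /fd.
by rewrite in_itv/= andbT ltr_norml => /andP[_]; rewrite ltrD2l ltrN2.
Qed.

Lemma BL1_measurable (psi : V -> R) : BL1 psi -> measurable_fun [set: borel V] psi.
Proof.
move=> [_ lip]; apply: continuous_borel_measurable => x e e0; exists e => // y.
exact: le_lt_trans.
Qed.

(* [psi] is, up to scaling, the inf-convolution [x |-> inf_y (f y + M/delta * mdist x y)]. *)
Lemma BL1_approx (f : V -> R) (M delta e : R) : 0 < M -> 0 < delta ->
  (forall x, 0 <= f x <= M) ->
  (forall x y, mdist x y < delta -> `|f x - f y| < e) ->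
  exists psi : V -> R, [/\ BL1 psi, forall x, 0 <= psi x &
    forall x, (M + M / delta) * psi x <= f x <= (M + M / delta) * psi x + e].
Proof.
move=> M0 d0 f0M fe.
have e0 : 0 < e by apply: le_lt_trans (fe point point _); rewrite ?mdistxx.
(* With this slope, points at distance at least [delta] pay a penalty of at least [M], so only
   nearer points can pull the infimum below [f x], and by at most [e]. *)
pose K := M / delta; have K0 : 0 < K by rewrite divr_gt0.
pose S x := range (fun y => f y + K * mdist x y).
have S0 x : lbound (S x) 0.
  by move=> _ [y _ <-]; have /andP[f0 _] := f0M y; rewrite addr_ge0// mulr_ge0 ?mdist_ge0// ltW.
have Sinf x : has_lbound (S x) by exists 0; exact: S0.
have Sne x : S x !=set0 by exists (f x + K * mdist x x), x.
pose L x := inf (S x).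
have L0 x : 0 <= L x by apply: lb_le_inf.
have Lf x : L x <= f x.
  by apply: ge_inf => //; exists x => //; rewrite mdistxx mulr0 addr0.
have fL x : f x <= L x + e.
  rewrite -lerBlDr; apply: lb_le_inf => // _ [y _ <-]; rewrite lerBlDr.
  have /andP[fy0 _] := f0M y.
  have [xy|xy] := ltP (mdist x y) delta.
    have := fe _ _ xy; rewrite ltr_norml => /andP[_ h].
    have : 0 <= K * mdist x y by rewrite mulr_ge0 ?mdist_ge0// ltW.
    lra.
  have : M <= K * mdist x y.
    by rewrite /K mulrAC -mulrA ler_peMr ?(ltW M0)// ler_pdivlMr// mul1r.
  have /andP[_ fxM] := f0M x.
  lra.
have Llip x y : L x - L y <= K * mdist x y.
  rewrite lerBlDl -lerBlDr; apply: lb_le_inf => // _ [z _ <-].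
  rewrite lerBlDr; apply: (@le_trans _ _ (f z + K * mdist x z)).
    by apply: ge_inf => //; exists z.
  rewrite -addrA lerD2l -mulrDr ler_pM2l//.
  by rewrite addrC; exact: metric_triangle.
have N0 : 0 < M + K by rewrite addr_gt0.
(* [L] is bounded by [M] and [K]-Lipschitz; dividing by [M + K] brings both constants below 1. *)
exists (fun x => (M + K)^-1 * L x); split.
- split => [x|x y].
    rewrite ger0_norm; last by rewrite mulr_ge0// invr_ge0 ltW.
    rewrite mulrC ler_pdivrMr// mul1r (le_trans (Lf x))//.
    by have /andP[_ ?] := f0M x; rewrite (@le_trans _ _ M)// lerDl ltW.
  rewrite -mulrBr normrM gtr0_norm ?invr_gt0// mulrC ler_pdivrMr//.
  apply: (@le_trans _ _ (K * mdist x y)).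
    rewrite ler_norml Llip andbT lerNl opprB metric_sym; exact: Llip.
  by rewrite mulrC ler_wpM2l ?mdist_ge0// lerDr ltW.
- by move=> x; rewrite mulr_ge0// invr_ge0 ltW.
- by move=> x; rewrite mulrA divff ?gt_eqF// mul1r Lf fL.
Qed.

End metric_regularity.

(** * Posterior means as ratios of lower integrals *)

Section posterior_mean.
Local Open Scope ereal_scope.
Context (R : realType) (V : pmetricType R) (U : ptopologicalType).
Local Notation Vb := (borel V).
Local Notation PV := (pprobability Vb R).
Variables (Pi : probability PV R) (p : U -> V -> R).
Hypothesis p0 : forall u nu, (0 <= p u nu)%R.
Hypothesis mp : forall u, measurable_fun [set: Vb] (p u).
Hypothesis p_bounded : forall u, exists M : R, forall nu, (p u nu <= M)%R.

(** The identity map on the space of probability measures is itself a probability kernel, and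
    integrals against a kernel are measurable in its parameter. *)
Lemma measurable_pprobability_integral (f : Vb -> \bar R) :
  (forall nu, 0 <= f nu) -> measurable_fun [set: Vb] f ->
  measurable_fun [set: PV] (fun G : PV => \int[G]_nu f nu).
Proof.
move=> f0 mf.
pose l := kprobability (@measurable_id _ PV setT).
by apply: (@measurable_fun_integral_kernel _ _ PV Vb R l) => // A mA; exact: measurable_kernel.
Qed.

Lemma probability_integral_le (G : PV) (f : V -> R) (M : R) :
  (forall nu, 0 <= f nu <= M)%R -> \int[G]_(nu in [set: Vb]) (f nu)%:E <= M%:E.
Proof.
move=> f0M; rewrite -[leRHS]mule1 -(@probability_setT _ _ _ G) -integral_cst//.
by apply: le_lower_integral => nu; rewrite lee_fin; have /andP[] := f0M nu.
Qed.

Lemma mG_ge0 (G : PV) u : 0 <= mG p G u.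
Proof. by apply: integral_ge0 => nu _; rewrite lee_fin. Qed.

Lemma measurable_mG u : measurable_fun [set: PV] (fun G => mG p G u).
Proof.
apply: measurable_pprobability_integral => [nu|]; first by rewrite lee_fin.
exact/measurable_EFinP.
Qed.

Lemma likG_ge0 (G : PV) us : 0 <= likG p G us.
Proof. by apply: prode_ge0 => u _; exact: mG_ge0. Qed.

Lemma measurable_likG us : measurable_fun [set: PV] (fun G => likG p G us).
Proof.
elim: us => [|u us IH]; rewrite /likG.
  by under eq_fun do rewrite big_nil; exact: measurable_cst.
under eq_fun do rewrite big_cons.
by apply: emeasurable_funM; [exact: measurable_mG|exact: IH].
Qed.

Lemma likG_bounded us : exists B : R, forall G, likG p G us <= B%:E.
Proof.
elim: us => [|u us [B IH]]; rewrite /likG.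
  by exists 1%R => G; rewrite big_nil.
have [M pM] := p_bounded u; exists (M * B)%R => G; rewrite big_cons EFinM.
apply: lee_pmul; [exact: mG_ge0|exact: likG_ge0| |exact: IH].
by apply: probability_integral_le => nu; rewrite p0 pM.
Qed.

(** The marginal likelihood of [us], that is, the denominator of [postmean]. *)
Definition postlik us := \int[Pi]_(G in [set: PV]) likG p G us.

Definition postnum us (f : V -> R) :=
  \int[Pi]_(G in [set: PV]) ((\int[G]_(nu in [set: Vb]) (f nu)%:E) * likG p G us).

Lemma postlik_fin us : postlik us \is a fin_num.
Proof.
rewrite ge0_fin_numE; last by apply: integral_ge0 => G _; exact: likG_ge0.
have [B lB] := likG_bounded us; apply: (@le_lt_trans _ _ B%:E); last exact: ltry.
rewrite -[leRHS]mule1 -(@probability_setT _ _ _ Pi) -integral_cst//.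
by apply: le_lower_integral => // G; exact: likG_ge0.
Qed.

Lemma postlik_ge0 us : 0 <= postlik us.
Proof. by apply: integral_ge0 => G _; exact: likG_ge0. Qed.

Lemma postnum_ge0 us f : (forall nu, 0 <= f nu)%R -> 0 <= postnum us f.
Proof.
move=> f0; apply: integral_ge0 => G _; apply: mule_ge0; last exact: likG_ge0.
by apply: integral_ge0 => nu _; rewrite lee_fin.
Qed.

Lemma le_postnum us f g : (forall nu, 0 <= f nu <= g nu)%R -> postnum us f <= postnum us g.
Proof.
move=> fg; have f0 nu : (0 <= f nu)%R by have /andP[] := fg nu.
have int0 (G : PV) : 0 <= \int[G]_(nu in [set: Vb]) (f nu)%:E.
  by apply: integral_ge0 => nu _; rewrite lee_fin.
apply: le_lower_integral => G; first by rewrite mule_ge0// likG_ge0.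
apply: lee_wpmul2r; first exact: likG_ge0.
by apply: le_lower_integral => nu; rewrite lee_fin//; have /andP[] := fg nu.
Qed.

Lemma postnum_affine us (f : V -> R) (a b : R) : (0 <= a)%R -> (0 <= b)%R ->
  (forall nu, 0 <= f nu)%R -> measurable_fun [set: Vb] f ->
  postnum us (fun nu => a * f nu + b)%R = a%:E * postnum us f + b%:E * postlik us.
Proof.
move=> a0 b0 f0 mf.
have mfE : measurable_fun [set: Vb] (fun nu => (f nu)%:E) by exact/measurable_EFinP.
have f0E nu : 0 <= (f nu)%:E by rewrite lee_fin.
have int0 (G : PV) : 0 <= \int[G]_(nu in [set: Vb]) (f nu)%:E by exact: integral_ge0.
have mint := measurable_pprobability_integral f0E mfE.
rewrite /postnum /postlik -ge0_integralZl_EFin//; last 2 first.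
- by move=> G _; rewrite mule_ge0// likG_ge0.
- by apply: emeasurable_funM => //; exact: measurable_likG.
rewrite -[b%:E * _]ge0_integralZl_EFin//; last 2 first.
- by move=> G _; exact: likG_ge0.
- exact: measurable_likG.
rewrite -ge0_integralD//; last 4 first.
- by move=> G _; rewrite !mule_ge0// likG_ge0.
- by apply: measurable_funeM; apply: emeasurable_funM => //; exact: measurable_likG.
- by move=> G _; rewrite mule_ge0// likG_ge0.
- by apply: measurable_funeM; exact: measurable_likG.
apply: eq_integral => G _.
have -> : \int[G]_(nu in [set: Vb]) (a * f nu + b)%:E =
    a%:E * (\int[G]_(nu in [set: Vb]) (f nu)%:E) + b%:E.
  under eq_integral do rewrite EFinD EFinM.
  rewrite ge0_integralD//; last 2 first.
  - by move=> nu _; rewrite mule_ge0.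
  - exact: measurable_funeM.
  rewrite ge0_integralZl_EFin//; congr (_ + _).
  by rewrite integral_cst// [X in _ * X]probability_setT mule1.
by rewrite ge0_muleDl ?mule_ge0// muleA.
Qed.

Lemma postnum_fin us (f : V -> R) (M : R) : (forall nu, 0 <= f nu <= M)%R ->
  postnum us f \is a fin_num.
Proof.
move=> f0M; have f0 nu : (0 <= f nu)%R by have /andP[] := f0M nu.
have M0 : (0 <= M)%R by have /andP[/le_trans + ?] := f0M point; apply.
rewrite ge0_fin_numE ?postnum_ge0//.
apply: (@le_lt_trans _ _ (M%:E * postlik us)).
  rewrite /postlik -ge0_integralZl_EFin//; last 2 first.
  - by move=> G _; exact: likG_ge0.
  - exact: measurable_likG.
  apply: le_lower_integral => G.
    by rewrite mule_ge0 ?likG_ge0// integral_ge0// => nu _; rewrite lee_fin.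
  by apply: lee_wpmul2r; [exact: likG_ge0|exact: probability_integral_le].
by rewrite -(fineK (postlik_fin us)) -EFinM ltry.
Qed.

(** [f] is not assumed measurable: linearity is applied to [psi] only, and [f] is reached by
    monotonicity. A nonzero marginal likelihood lets the constant [e] have posterior mean [e]. *)
Lemma postmean_sandwich us (f psi : V -> R) (a e M : R) :
  fine (postlik us) != 0%R -> (0 <= a)%R -> (0 <= e)%R ->
  (forall nu, 0 <= f nu <= M)%R -> (forall nu, 0 <= psi nu <= M)%R ->
  measurable_fun [set: Vb] psi ->
  (forall nu, a * psi nu <= f nu <= a * psi nu + e)%R ->
  (a * postmean Pi p us psi <= postmean Pi p us f <= a * postmean Pi p us psi + e)%R.
Proof.
move=> l0 a0 e0 f0M psi0M mpsi fpsi.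
have psi0 nu : (0 <= psi nu)%R by have /andP[] := psi0M nu.
have f0 nu : (0 <= f nu)%R by have /andP[] := f0M nu.
have lgt0 : (0 < fine (postlik us))%R by rewrite lt_neqAle eq_sym l0 fine_ge0// postlik_ge0.
have E (b : R) : (0 <= b)%R -> (fine (postnum us (fun nu => a * psi nu + b)) =
    a * fine (postnum us psi) + b * fine (postlik us))%R.
  move=> b0; rewrite postnum_affine// fineD ?fineM ?fin_numM ?(postnum_fin _ psi0M) ?postlik_fin//.
have le_fine g h : (forall nu, 0 <= g nu <= h nu)%R ->
    postnum us h \is a fin_num -> (fine (postnum us g) <= fine (postnum us h))%R.
  move=> gh hfin; have le_gh := le_postnum us gh.
  have g0 : 0 <= postnum us g by apply: postnum_ge0 => nu; have /andP[] := gh nu.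
  apply: (fine_le _ hfin le_gh).
  rewrite (ge0_fin_numE g0); apply: (le_lt_trans le_gh).
  by rewrite -(ge0_fin_numE (le_trans g0 le_gh)).
have -> : postmean Pi p us psi = (fine (postnum us psi) / fine (postlik us))%R by [].
have -> : postmean Pi p us f = (fine (postnum us f) / fine (postlik us))%R by [].
rewrite mulrA; apply/andP; split.
  rewrite ler_pM2r ?invr_gt0//.
  have := E 0%R (lexx _); rewrite mul0r addr0 => <-; apply: le_fine; last exact: postnum_fin f0M.
  by move=> nu; have /andP[+ _] := fpsi nu; rewrite addr0 => ->; rewrite mulr_ge0.
rewrite -[in leRHS](mulfK l0 e) -mulrDl ler_pM2r; last by rewrite invr_gt0.
rewrite -(E e e0).
apply: le_fine => [nu|]; first by have /andP[_ ->] := fpsi nu; rewrite f0.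
rewrite (@postnum_fin _ _ (a * M + e)%R)// => nu.
have /andP[p1 p2] := psi0M nu.
by rewrite addr_ge0 ?mulr_ge0//= lerD2r ler_wpM2l.
Qed.

Lemma DBL_ge us nus psi : BL1 psi ->
  (`| postmean Pi p us psi - (size nus)%:R^-1 * \sum_(nu <- nus) psi nu |)%:E <=
  DBL_post_emp Pi p us nus.
Proof. by move=> bl; apply: ereal_sup_ubound; exists psi. Qed.

Lemma DBL_ge0 us nus : 0 <= DBL_post_emp Pi p us nus.
Proof.
apply: (le_trans _ (@DBL_ge us nus (fun=> 0%R) _)); first by rewrite lee_fin.
by split => [x|x y]; rewrite ?subrr normr0 ?ler01// mdist_ge0.
Qed.

(* If the marginal likelihood vanishes, [postmean] takes the junk value [0] (division
   by zero), which the constant test function [1] detects at distance [1]. *)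
Lemma postlik_neq0 us nus : nus != [::] -> DBL_post_emp Pi p us nus < 1 ->
  fine (postlik us) != 0%R.
Proof.
move=> nus0 D1; apply/eqP => l0.
have bl : BL1 (fun _ : V => 1%R : R).
  by split => [x|x y]; rewrite ?normr1// subrr normr0 mdist_ge0.
have := le_lt_trans (DBL_ge us nus (psi := fun=> 1%R) bl) D1.
have -> : postmean Pi p us (fun=> 1%R) = 0%R.
  by rewrite /postmean -/(postlik us) l0 invr0 mulr0.
rewrite big_const_seq count_predT iter_addr_0 mulVf ?pnatr_eq0 ?size_eq0//.
by rewrite sub0r normrN normr1 ltxx.
Qed.

(** Up to [e], [f] is a multiple of a bounded Lipschitz function. The posterior and empirical means
    of [f] are sandwiched alike between those of this multiple, which differ by at most the factor
    times [d]. *)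
Lemma postmean_emp_close us nus (f : V -> R) (M delta e d : R) :
  nus != [::] -> (0 < M)%R -> (0 < delta)%R -> (d <= 1)%R ->
  (forall x, 0 <= f x <= M)%R ->
  (forall x y, mdist x y < delta -> `|f x - f y| < e)%R ->
  DBL_post_emp Pi p us nus < d%:E ->
  (`| postmean Pi p us f - (size nus)%:R^-1 * \sum_(nu <- nus) f nu |
     <= (M + M / delta) * d + e)%R.
Proof.
move=> nus0 M0 delta0 d1 f0M fe Dd.
have l0 : fine (postlik us) != 0%R.
  by apply: (postlik_neq0 nus0); apply: lt_le_trans Dd _; rewrite lee_fin.
have [psi [bl psi0 fpsi]] := BL1_approx M0 delta0 f0M fe.
have e0 : (0 < e)%R by apply: le_lt_trans (fe point point _); rewrite ?mdistxx.
set a := (M + M / delta)%R in fpsi *.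
have a0 : (0 <= a)%R by rewrite addr_ge0 ?divr_ge0// ltW.
(* The sandwich wants one bound for both functions; [psi] is bounded by 1, not by [M]. *)
have M1 nu : (0 <= f nu <= Num.max M 1)%R.
  by have /andP[-> fM] := f0M nu; rewrite le_max fM.
have psi1 nu : (0 <= psi nu <= Num.max M 1)%R.
  by rewrite psi0 le_max (le_trans (ler_norm _) (bl.1 nu)) orbT.
have /andP[h1 h2] := postmean_sandwich l0 a0 (ltW e0) M1 psi1 (BL1_measurable bl) fpsi.
have := le_lt_trans (DBL_ge us nus bl) Dd; rewrite lte_fin.
set Hpsi := postmean _ _ _ psi in h1 h2 *; set Hf := postmean _ _ _ f in h1 h2 *.
have N0 : (0 < (size nus)%:R :> R)%R by rewrite ltr0n lt0n size_eq0.
set Epsi := ((size nus)%:R^-1 * \sum_(nu <- nus) psi nu)%R.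
set Ef := ((size nus)%:R^-1 * \sum_(nu <- nus) f nu)%R.
have E1 : (a * Epsi <= Ef)%R.
  rewrite /Epsi mulrCA ler_pM2l ?invr_gt0// mulr_sumr ler_sum// => nu _.
  by have /andP[] := fpsi nu.
have E2 : (Ef <= a * Epsi + e)%R.
  have -> : (e = (size nus)%:R^-1 * \sum_(nu <- nus) e)%R.
    by rewrite big_const_seq count_predT iter_addr_0 -[(e *+ _)%R]mulr_natl mulKf ?lt0r_neq0.
  rewrite /Epsi mulrCA -mulrDr ler_pM2l ?invr_gt0// mulr_sumr -big_split/=.
  by apply: ler_sum => nu _; have /andP[] := fpsi nu.
rewrite ltr_norml => /andP[hl hu].
have k1 : (a * (Hpsi - Epsi) <= a * d)%R by rewrite ler_wpM2l// ltW.
have k2 : (a * (Epsi - Hpsi) <= a * d)%R by rewrite ler_wpM2l// -opprB lerNl ltW.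
rewrite mulrBr in k1; rewrite mulrBr in k2.
by rewrite ler_norml; apply/andP; split; lra.
Qed.

End posterior_mean.

(** * Leaving one unit out *)

Section leave_one_out.
Local Open Scope ereal_scope.

Lemma iota_split n i : (i < n)%N -> iota 0 n = iota 0 i ++ i :: iota i.+1 (n - i.+1).
Proof.
by move=> lin; rewrite -{1}(subnKC (ltnW lin)) iotaD add0n -(subnSK lin).
Qed.

Lemma iota_rem n i : (i < n)%N ->
  [seq j <- iota 0 n | j != i] = iota 0 i ++ iota i.+1 (n - i.+1).
Proof.
move=> lin; rewrite (iota_split lin) filter_cat/= eqxx; congr (_ ++ _);
  by apply/all_filterP/allP => j; rewrite mem_iota; lia.
Qed.

(** Used with [F] charging the exceptional events in the data of unit [i], and with [g] a distance
    computed from the other units and [c] an inverse threshold, as in Markov's inequality. *)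
Lemma iprod_int_leave_one_out_le d (X : measurableType d) (R : realType)
    (ker : nat -> probability X R) (n i : nat) (F : X -> \bar R) (c : R)
    (f g : seq X -> \bar R) : (i < n)%N ->
  (forall x, 0 <= F x) -> (0 < c)%R -> (forall xs, 0 <= g xs) ->
  (forall xs, 0 <= f xs) ->
  (forall xs x ys, size xs = i -> size ys = (n - i.+1)%N ->
     f (xs ++ x :: ys) <= F x + c%:E * g (xs ++ ys)) ->
  iprod_int [seq ker j | j <- iota 0 n] f <=
  \int[ker i]_x F x + c%:E * iprod_int [seq ker j | j <- iota 0 n & j != i] g.
Proof.
move=> lin F0 c0 g0 f0 H; rewrite iota_rem// (iota_split lin) !map_cat/=.
by apply: iprod_int_split_le => // xs x ys; rewrite !size_map !size_iota; exact: H.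
Qed.

Context (R : realType) (V : pmetricType R) (U : ptopologicalType).
Local Notation Vb := (borel V).
Local Notation PV := (pprobability Vb R).
Variables (Pi : probability PV R) (p : U -> V -> R).

Lemma prod_mG_leave_one_out (G : PV) us1 u us2 :
  \prod_(j < size (us1 ++ u :: us2) | j != size us1 :> nat)
    mG p G (nth point (us1 ++ u :: us2) j) = likG p G (us1 ++ us2).
Proof.
rewrite -(big_mkord (fun j => j != size us1)
  (fun j => mG p G (nth point (us1 ++ u :: us2) j))).
rewrite /index_iota subn0 -big_filter iota_rem; last by rewrite size_cat/= -addSnnS leq_addr.
rewrite big_cat /likG big_cat/=; congr (_ * _).
  rewrite [RHS](big_nth point) /index_iota subn0; apply: eq_big_seq => j.
  by rewrite mem_iota add0n nth_cat => /= ->.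
rewrite [RHS](big_nth point) /index_iota subn0 size_cat/= -addSnnS addKn.
rewrite -[(size us1).+1]addn0 iotaDl big_map; apply: eq_bigr => j _.
by rewrite nth_cat addSn ltnNge -addnS leq_addr/= addKn.
Qed.

(** By Bayes' formula the other units enter only through their likelihood; dividing numerator and
    denominator by its integral turns each into a posterior mean. *)
Lemma Pfrak_leave_one_out (condT : V -> U -> probability R R) us1 u us2 (t : R) :
  fine (postlik Pi p (us1 ++ us2)) != 0%R ->
  Pfrak Pi p condT (size us1) t (us1 ++ u :: us2) =
  (postmean Pi p (us1 ++ us2) (fun nu => fine (Por condT t u nu) * p u nu) /
   postmean Pi p (us1 ++ us2) (p u))%R.
Proof.
move=> l0; rewrite /Pfrak /postmean -/(postlik Pi p (us1 ++ us2)).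
set l := fine (postlik _ _ _) in l0 *.
have cancel_l x y : ((x / l) / (y / l) = x / y)%R.
  by rewrite invfM invrK mulrACA mulVf ?mulr1.
rewrite cancel_l.
have -> : nth point (us1 ++ u :: us2) (size us1) = u by rewrite nth_cat ltnn subnn.
congr (fine _ * (fine _)^-1)%R; apply: eq_integral => G _.
  rewrite prod_mG_leave_one_out; congr (_ * _); apply: eq_integral => nu _.
  by rewrite EFinM fineK// /Por fin_num_measure//; exact: measurable_tail.
by rewrite /likG !big_cat/= big_cons muleCA.
Qed.

Hypothesis p0 : forall u nu, (0 <= p u nu)%R.
Hypothesis mp : forall u, measurable_fun [set: Vb] (p u).
Hypothesis p_bounded : forall u, exists M : R, forall nu, (p u nu <= M)%R.

Lemma Por_ge0_le1 (condT : V -> U -> probability R R) (t : R) u nu :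
  (0 <= fine (Por condT t u nu) <= 1)%R.
Proof.
rewrite fine_ge0//= -lee_fin fineK.
  by apply: probability_le1; exact: measurable_tail.
by rewrite /Por fin_num_measure//; exact: measurable_tail.
Qed.

(** Both posterior means in the leave-one-out ratio are close to averages over the [n - 1] other
    units; restoring the missing unit costs at most [M]. The total error is at most [n * eps * eta],
    which a mixture density above [eta] absorbs into [eps]. *)
Lemma Pfrak_le_mixture (condT : V -> U -> probability R R) us1 u us2 nus1 nu0 nus2
    (t alpha M delta e d eps eta : R) :
  let n := size (nus1 ++ nu0 :: nus2) in
  let S f := (\sum_(nu <- nus1 ++ nu0 :: nus2) f nu)%R in
  nus1 ++ nus2 != [::] ->
  (0 <= alpha <= 1)%R -> (0 < M)%R -> (0 < delta)%R -> (0 < eps <= 1)%R -> (0 < eta)%R ->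
  (d <= 1)%R -> (forall nu, p u nu <= M)%R ->
  (forall x y, mdist x y < delta -> `|p u x - p u y| < e)%R ->
  (forall x y, mdist x y < delta ->
     `|fine (Por condT t u x) * p u x - fine (Por condT t u y) * p u y| < e)%R ->
  (2 * ((M + M / delta) * d + e) + M / n%:R <= eps * eta)%R ->
  DBL_post_emp Pi p (us1 ++ us2) (nus1 ++ nus2) < d%:E ->
  (n%:R * eta < S (p u))%R ->
  (Pfrak Pi p condT (size us1) t (us1 ++ u :: us2) <= alpha)%R ->
  (S (fun nu => fine (Por condT t u nu) * p u nu) <= (alpha + eps) * S (p u))%R.
Proof.
move=> n S nus0 /andP[a0 a1] M0 delta0 /andP[eps0 eps1] eta0 d1 pM pe Pe small Dd Sbig.
have l0 : fine (postlik Pi p (us1 ++ us2)) != 0%R.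
  by apply: (postlik_neq0 nus0); apply: lt_le_trans Dd _; rewrite lee_fin.
rewrite Pfrak_leave_one_out//.
pose f1 nu := (fine (Por condT t u nu) * p u nu)%R.
have f2b nu : (0 <= p u nu <= M)%R by rewrite p0 pM.
have f1b nu : (0 <= f1 nu <= M)%R.
  have /andP[P0 P1] := Por_ge0_le1 condT t u nu.
  by rewrite mulr_ge0//= (le_trans _ (pM nu))// ler_piMl.
have := postmean_emp_close p0 mp p_bounded nus0 M0 delta0 d1 f1b Pe Dd.
have := postmean_emp_close p0 mp p_bounded nus0 M0 delta0 d1 f2b pe Dd.
rewrite -/f1; set r := (_ * d + e)%R in small *.
set H1 := postmean _ _ _ f1; set H2 := postmean _ _ _ _.
set m := (size (nus1 ++ nus2))%:R; set T1 := (\sum_(nu <- _) f1 nu)%R.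
set T2 := (\sum_(nu <- _) p u nu)%R.
have m0 : (0 < m :> R)%R by rewrite ltr0n lt0n size_eq0.
have nE : (n%:R = m + 1 :> R)%R by rewrite natr1 /n /m !size_cat/= addnS.
have S1E : (S f1 = T1 + f1 nu0)%R by rewrite /S /T1 !big_cat big_cons/= addrCA addrC.
have S2E : (S (p u) = T2 + p u nu0)%R by rewrite /S /T2 !big_cat big_cons/= addrCA addrC.
have clear H T : (`|H - m^-1 * T| <= r -> `|m * H - T| <= m * r)%R.
  move=> HT; have -> : (m * H - T = m * (H - m^-1 * T))%R by rewrite mulrBr mulVKf// gt_eqF.
  by rewrite normrM gtr0_norm// ler_wpM2l// ltW.
move=> /clear/ler_normlP[c1 c2] /clear/ler_normlP[c3 c4].
clearbody r H1 H2 T1 T2 m.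
have r0 : (0 <= r)%R by rewrite -(pmulr_rge0 _ m0); lra.
have small' : (2 * (n%:R * r) + M <= n%:R * (eps * eta))%R.
  rewrite (le_trans _ (ler_wpM2l _ small)) ?ler0n//.
  rewrite mulrDr [(n%:R * (2 * r))%R]mulrCA [(n%:R * (M / _))%R]mulrCA mulfV ?mulr1//.
  by rewrite nE gt_eqF// addr_gt0.
have mn : (m * r <= n%:R * r)%R by rewrite nE ler_wpM2r// lerDl.
have etaS : (n%:R * (eps * eta) <= eps * S (p u))%R.
  by rewrite mulrCA ler_wpM2l ?ltW.
have etaS' : (n%:R * (eps * eta) <= n%:R * eta)%R.
  by rewrite ler_wpM2l// ler_piMl// ltW.
have nr0 : (0 <= n%:R * r)%R by rewrite mulr_ge0.
have /andP[f10 f1M] := f1b nu0; have /andP[f20 f2M] := f2b nu0.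
(* The denominator is positive because the mixture sum exceeds [n * eta], which dominates the
   errors. *)
have H2gt0 : (0 < H2)%R by rewrite -(pmulr_rgt0 _ m0); lra.
rewrite ler_pdivrMr// => HH.
(* Chain: [T1 <= m * H1 + m * r], then [m * H1 <= alpha * (T2 + m * r)], and [alpha <= 1] bounds the
   accumulated error by [2 * (m * r)]. *)
have k1 : (m * H1 <= alpha * (m * H2))%R by rewrite mulrCA ler_wpM2l// ltW.
have k2 : (alpha * (m * H2) <= alpha * (T2 + m * r))%R by rewrite ler_wpM2l//; lra.
have k3 : (alpha * (m * r) <= m * r)%R by rewrite ler_piMl// mulr_ge0// ltW.
have k4 : (alpha * T2 <= alpha * S (p u))%R by rewrite ler_wpM2l//; lra.
rewrite -/f1 S1E mulrDl; rewrite mulrDr in k2; lra.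
Qed.

End leave_one_out.

(** * Asymptotic compound p-values *)

Lemma limn_esup_le (R : realType) (u : (\bar R)^nat) (l : \bar R) :
  (\forall n \near \oo, (u n <= l)%E) -> (limn_esup u <= l)%E.
Proof.
move=> ul; apply: (@le_trans _ _ (ereal_sup (u @` [set n | (u n <= l)%E]))).
  by apply: ereal_inf_lbound; exists [set n | (u n <= l)%E].
by apply/ge_ereal_sup => _ [n /= un <-].
Qed.

(** * Regularity of densities and oracle p-values in the nuisance parameter *)

Section nuisance_regularity.
Context (R : realType) (V : pmetricType R) (U : ptopologicalType).
Variable p : U -> V -> R.
Hypothesis p0 : forall u nu, 0 <= p u nu.
Hypothesis p_regular : forall C : set U, compact C ->
  (exists M : R, forall u nu, C u -> `|p u nu| <= M) /\
  forall nu0 (e : R), 0 < e -> exists2 delta : R, 0 < delta &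
    forall u nu, C u -> mdist nu0 nu < delta -> `|p u nu - p u nu0| < e.

(** A singleton is compact, so the regularity on compact sets applies at each single [u]. *)
Lemma density_bounded u : exists M : R, forall nu, p u nu <= M.
Proof.
have [[M pM] _] := p_regular (@compact_set1 _ u).
by exists M => nu; rewrite (le_trans (ler_norm _))// pM.
Qed.

Lemma density_measurable u : measurable_fun [set: borel V] (p u).
Proof.
have [_ eqp] := p_regular (@compact_set1 _ u).
apply: continuous_borel_measurable => x e /(eqp x)[d d0 pd]; exists d => // y xy.
by rewrite distrC pd.
Qed.

(** Product rule: the oracle p-value is at most 1 and the density at most [M] on [C], so tolerances
    [e / 2] for the density and [e / (2 * M)] for the p-value suffice. *)
Lemma oracle_density_equicontinuous (condT : V -> U -> probability R R) (C : set U)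
    (M e : R) : compact [set: V] -> compact C -> 0 < M ->
  (forall u nu, C u -> p u nu <= M) ->
  (forall e : R, 0 < e -> exists2 delta : R, 0 < delta &
     forall t u nu nu', mdist nu nu' < delta ->
       `| fine (Por condT t u nu) - fine (Por condT t u nu') | < e) ->
  0 < e -> exists2 delta : R, 0 < delta & forall u x y, C u -> mdist x y < delta ->
    `|p u x - p u y| < e /\
    forall t, `|fine (Por condT t u x) * p u x - fine (Por condT t u y) * p u y| < e.
Proof.
move=> cV cC M0 pM Peq e0.
have e20 : 0 < e / 2 by rewrite divr_gt0.
have [d1 d10 H1] := uniform_equicontinuous cV (p_regular cC).2 e20.
have [d2 d20 H2] := Peq (e / (2 * M)) (divr_gt0 e0 (mulr_gt0 (ltr0n R 2) M0)).
exists (Num.min d1 d2); first by rewrite lt_min d10 d20.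
move=> u x y Cu; rewrite lt_min => /andP[/(H1 u x y Cu) pxy xy2].
split => [|t]; first by apply: lt_trans pxy _; rewrite ltr_pdivrMr// ltr_pMr// ltr1n.
have Pxy := H2 t u _ _ xy2; have /andP[P0 P1] := Por_ge0_le1 condT t u x.
move: Pxy P0 P1; set a := fine _; set b := fine _ => ab a0 a1.
have -> : a * p u x - b * p u y = a * (p u x - p u y) + (a - b) * p u y by ring.
rewrite (le_lt_trans (ler_normD _ _))// [ltRHS]splitr ltr_leD//.
  by rewrite normrM (ger0_norm a0) (le_lt_trans _ pxy)// ler_piMl.
rewrite normrM (ger0_norm (p0 _ _)).
rewrite (le_trans (ler_pM _ _ (ltW ab) (pM _ y Cu)))//.
by rewrite invfM mulrA divfK ?gt_eqF.
Qed.

End nuisance_regularity.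

Unset Implicit Arguments.

Theorem theorem4 (R : realType) (V : pmetricType R) (U : ptopologicalType)
  (Theta : Type) (theta0 : Theta)
  (kern : Theta -> V -> probability (R * borel U)%type R)
  (lam : {measure set borel U -> \bar R})
  (p : U -> V -> R)
  (condT : V -> U -> probability R R)
  (Pi : probability (pprobability (borel V) R) R)
  (thetas : nat -> nat -> Theta) (nus : nat -> nat -> V) :
  (* the law of U_i depends only on nu_i *)
  (forall th th' nu (A : set (borel U)), measurable A ->
     Ulaw kern th nu A = Ulaw kern th' nu A) ->
  (* condT nu u is the conditional law of T_i given nu_i = nu, U_i = u,
     under theta_i = theta0 *)
  (forall nu (A : set R) (B : set (borel U)), measurable A -> measurable B ->
     kern theta0 nu (A `*` B) =
     (\int[lam]_(u in B) (condT nu u A * (p u nu)%:E))%E) ->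
  (* Assumption 1 *)
  (forall nu u, condT nu u `<< (@lebesgue_measure R)) ->
  (* Assumption 2 *)
  compact [set: V] ->
  (* Assumption 3 *)
  (forall e : R, 0 < e -> exists2 delta : R, 0 < delta &
     forall t u nu nu', mdist nu nu' < delta ->
       `| fine (Por condT t u nu) - fine (Por condT t u nu') | < e) ->
  (* Assumption 4 *)
  (forall e : R, 0 < e -> exists C : set U,
     [/\ compact C, measurable (C : set (borel U)) &
         forall nu, (Ulaw kern theta0 nu (~` C) <= e%:E)%E]) ->
  (forall u nu, 0 <= p u nu) ->
  (forall nu, measurable_fun [set: borel U] (fun u => p u nu)) ->
  (forall th nu (A : set (borel U)), measurable A ->
     Ulaw kern th nu A = (\int[lam]_(u in A) (p u nu)%:E)%E) ->
  (forall C : set U, compact C ->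
     [/\ (lam C < +oo)%E,
         exists M : R, forall u nu, C u -> `|p u nu| <= M &
         forall nu0 (e : R), 0 < e -> exists2 delta : R, 0 < delta &
           forall u nu, C u -> mdist nu0 nu < delta ->
             `|p u nu - p u nu0| < e]) ->
  (* consistency of the posterior mean of G *)
  ((fun n : nat => \big[Order.max/0%E]_(i < n)
      iprod_int [seq kern (thetas n j) (nus n j) | j <- iota 0 n & j != nat_of_ord i]
        (fun zs => DBL_post_emp Pi p (map snd zs)
                     [seq nus n j | j <- iota 0 n & j != nat_of_ord i]))
     @ \oo --> 0%E) ->
  (* conclusion: P_1,...,P_n are asymptotic compound p-values *)
  (limn_esup (fun n : nat =>
     ereal_sup [set Order.max
        ((n%:R^-1)%:E *
           (\sum_(i < n | `[< thetas n i = theta0 >])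
              iprod_int [seq kern (thetas n j) (nus n j) | j <- iota 0 n]
                (fun zs => ((Pfrak Pi p condT i (nth (0, point) zs i).1
                                (map snd zs) <= alpha)%R%:R)%:E)) -
         alpha%:E) 0
      | alpha in (`[0%R, 1%R]%classic : set R)]) <= 0)%E.
Proof.
move=> Ulaw_th kern_condT _ cV Por_eq tight p0 mp Ulaw_p p_reg cons.
have p_reg' C : compact C ->
  (exists M : R, forall u nu, C u -> `|p u nu| <= M) /\
  forall nu0 (e : R), 0 < e -> exists2 delta : R, 0 < delta &
    forall u nu, C u -> mdist nu0 nu < delta -> `|p u nu - p u nu0| < e.
  by move=> cC; have [_ ? ?] := p_reg C cC.
have mpV := density_measurable p_reg'; have p_bnd := density_bounded p_reg'.
apply/lee_addgt0Pr => eps' eps'0; rewrite add0e.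
(* Four losses of [eps] will occur: the level of the mixture p-value, the mass outside [C], small
   mixture density, and Markov's inequality. *)
pose eps := Num.min (eps' / 4) 1.
have eps0 : 0 < eps by rewrite lt_min divr_gt0//= ltr01.
have eps1 : eps <= 1 by rewrite ge_min lexx orbT.
have eps4 : 4 * eps <= eps'.
  by rewrite mulrC -ler_pdivlMr// ge_min lexx.
have [C [cC mC UC]] := tight _ eps0.
have [lamC [M0 pM0] _] := p_reg C cC.
pose M := Num.max M0 1.
have Mgt0 : 0 < M by rewrite lt_max ltr01 orbT.
have pM u nu : C u -> p u nu <= M.
  by move=> Cu; rewrite le_max (le_trans (ler_norm _) (pM0 u nu Cu)).
have lamC0 : 0 <= fine (lam C) by rewrite fine_ge0.
(* The added 1 guards against [lam C = 0]. *)
pose eta := eps / (fine (lam C) + 1).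
have eta0 : 0 < eta by rewrite divr_gt0// ltr_wpDl.
have etaC : eta * fine (lam C) <= eps.
  by rewrite /eta mulrAC ler_pdivrMr ?ltr_wpDl// ler_pM2l// lerDl.
(* The error budget of [Pfrak_le_mixture] will be [2 * (r + r) + r], within [6 * r = eps * eta]. *)
pose r := eps * eta / 6; have r0 : 0 < r by rewrite divr_gt0// mulr_gt0.
have [delta delta0 equi] :=
  oracle_density_equicontinuous p0 p_reg' cV cC Mgt0 pM Por_eq r0.
pose K := M + M / delta; have K0 : 0 < K by rewrite addr_gt0// divr_gt0.
pose d := Num.min 1 (r / K); have d0 : 0 < d by rewrite lt_min ltr01 divr_gt0.
have d1 : d <= 1 by rewrite ge_min lexx.
have Kd : K * d <= r by rewrite mulrC -ler_pdivlMr// ge_min lexx orbT.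
set H : nat -> \bar R := fun n => (\big[Order.max/0%E]_(i < n) _)%E in cons.
(* Markov's inequality at threshold [d] will divide this bound by [d] and leave [eps]. *)
have consH : \forall n \near \oo, (H n < (d * eps)%:E)%E.
  apply: (cons [set x | x < (d * eps)%:E]%E).
  by apply: open_nbhs_nbhs; split; [exact: open_ereal_lt_ereal|rewrite /= lte_fin mulr_gt0].
apply: limn_esup_le; near=> n.
(* At least two units, so that leaving one out leaves a nonempty list. *)
have n2 : (1 < n)%N by near: n; exact: nbhs_infty_gt.
have n0 : (0 < n%:R :> R) by rewrite ltr0n ltnW.
have Mn : M / n%:R <= r.
  rewrite ler_pdivrMr// mulrC -ler_pdivrMr// ltW//.
  by near: n; exact: nbhs_infty_gtr.
have Hn : (H n < (d * eps)%:E)%E by near: n; exact: consH.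
apply/ge_ereal_sup => _ [alpha /= + <-]; rewrite in_itv/= => /andP[al0 al1].
rewrite ge_max lee_fin (ltW eps'0) andbT EFinN leeBlDr//.
(* The event that the mixture p-value is at most [alpha + eps], written without division. Neither it
   nor [F] depends on the unit, as averaging over units requires. *)
pose S : set (R * U) := [set z | (\sum_(i < n) condT (nus n i) z.2 [set x | (`|z.1| <= `|x|)%R]
  * (p z.2 (nus n i))%:E <= (alpha + eps)%:E * \sum_(i < n) (p z.2 (nus n i))%:E)%E].
pose B := C `&` [set u | \sum_(i < n) p u (nus n i) <= n%:R * eta].
pose F (z : R * borel U) : \bar R := ((\1_S z)%:E +
     ((\1_([set: R] `*` ~` C) z)%:E + (\1_([set: R] `*` B) z)%:E))%E.
have F0 z : (0 <= F z)%E by rewrite /F !adde_ge0// lee_fin.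
have F1 z : S z \/ ~ C z.2 \/ B z.2 -> (1 <= F z)%E.
  have ind0 A : 0 <= (\1_A z : R) by [].
  rewrite /F -!EFinD lee_fin => -[Sz|[Cz|Bz]].
  - by rewrite [X in X + _]indicE mem_set// lerDl addr_ge0.
  - rewrite [X in _ + (X + _)]indicE mem_set; last by split.
    by rewrite addrCA lerDl addr_ge0.
  - rewrite [X in _ + (_ + X)]indicE [X in _ + (_ + (nat_of_bool X)%:R)]mem_set; last by split.
    by rewrite addrA lerDr addr_ge0.
have unit_le (i : 'I_n) : thetas n i = theta0 ->
  (iprod_int [seq kern (thetas n j) (nus n j) | j <- iota 0 n]
     (fun zs => ((Pfrak Pi p condT i (nth (0, point) zs i).1
                                (map snd zs) <= alpha)%R%:R)%:E)
   <= \int[kern theta0 (nus n i)]_z F z + eps%:E)%E.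
  move=> thi.
  have := @iprod_int_leave_one_out_le _ _ R (fun j => kern (thetas n j) (nus n j)) n i F d^-1
    (fun zs => ((Pfrak Pi p condT i (nth (0, point) zs i).1 (map snd zs) <= alpha)%R%:R)%:E)
    (fun zs => DBL_post_emp Pi p (map snd zs)
                     [seq nus n j | j <- iota 0 n & j != nat_of_ord i]) (ltn_ord i) F0.
  rewrite thi invr_gt0 => /(_ d0 _ _ _)/le_trans; apply.
  - by move=> xs; exact: DBL_ge0.
  - by move=> xs; rewrite lee_fin.
  - move=> xs [t u] ys sxs sys.
    rewrite !map_cat/= nth_cat sxs ltnn subnn/=.
    set D := DBL_post_emp _ _ _ _.
    have D0 : (0 <= D)%E by exact: DBL_ge0.
    have dD0 : (0 <= (d^-1)%:E * D)%E by rewrite mule_ge0// lee_fin invr_ge0 ltW.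
    have of1 : (1 <= F (t, u) -> forall b : bool, (b%:R)%:E <= F (t, u) + (d^-1)%:E * D)%E.
      move=> FF b; rewrite (le_trans _ (leeDl _ dD0))// (le_trans _ FF)// lee_fin.
      by case: b.
    (* If [u] is outside [C] or the mixture density is small, [F] is at least 1; if [D] is at least
       [d], the Markov term is. Otherwise [P_i <= alpha] forces membership in [S]. *)
    have [Cu|Cu] := pselect (C u); last by apply: of1; apply: F1; right; left.
    have [small|big] := lerP (\sum_(j < n) p u (nus n j)) (n%:R * eta).
      by apply: of1; apply: F1; right; right.
    have [dD|Dd] := leP d%:E D.
      rewrite (le_trans _ (leeDr _ (F0 _)))// (@le_trans _ _ 1%E)//.
        by rewrite lee_fin lern1 leq_b1.
      by rewrite lee_pdivlMl// mule1.
    have [Palpha|_] := boolP (_ <= alpha); last by rewrite adde_ge0.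
    suff Stu : S (t, u) by have /of1/(_ true) := F1 _ (or_introl Stu).
    have iotaE : [seq nus n j | j <- iota 0 n] = [seq nus n j | j <- iota 0 i] ++
        nus n i :: [seq nus n j | j <- iota i.+1 (n - i.+1)].
      by rewrite (iota_split (ltn_ord i)) map_cat.
    have sumE (f : V -> R) : \sum_(nu <- [seq nus n j | j <- iota 0 i] ++
        nus n i :: [seq nus n j | j <- iota i.+1 (n - i.+1)]) f nu = \sum_(j < n) f (nus n j).
      rewrite -iotaE big_map; transitivity (\sum_(0 <= j < n) f (nus n j)); last exact: big_mkord.
      by rewrite /index_iota subn0.
    have szE : size ([seq nus n j | j <- iota 0 i] ++
        nus n i :: [seq nus n j | j <- iota i.+1 (n - i.+1)]) = n.
      by rewrite -iotaE size_map size_iota.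
    have := @Pfrak_le_mixture R V U Pi p p0 mpV p_bnd condT (map snd xs) u (map snd ys)
      [seq nus n j | j <- iota 0 i] (nus n i) [seq nus n j | j <- iota i.+1 (n - i.+1)]
      t alpha M delta r d eps eta.
    cbv beta zeta; rewrite !sumE szE size_map sxs => mix.
    rewrite /S/= [X in (_ <= _ * X)%E]sumEFin -EFinM.
    rewrite (eq_bigr (fun j : 'I_n =>
      (fine (Por condT t u (nus n j)) * p u (nus n j))%:E)); last first.
      move=> j _; rewrite EFinM fineK// /Por fin_num_measure//; exact: measurable_tail.
    rewrite sumEFin lee_fin; apply: mix => //.
    - rewrite -size_eq0 size_cat !size_map !size_iota addnBA; last exact: ltn_ord.
      by rewrite -addn1 subnDl subn_eq0 -ltnNge.
    - by rewrite al0.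
    - by rewrite eps0.
    - by move=> nu; exact: pM.
    - by move=> x y /(equi u x y Cu)[].
    - by move=> x y /(equi u x y Cu)[].
    - rewrite -/K; have : 6 * r = eps * eta by rewrite /r mulrC divfK.
      lra.
    - by rewrite -(map_cat (nus n)) -iota_rem.

  apply: leeD2l; rewrite lee_pdivrMl// -EFinM ltW//.
  apply: le_lt_trans Hn.
  exact: (@le_bigmax _ _ _ 0%E (fun i : 'I_n =>
      iprod_int [seq kern (thetas n j) (nus n j) | j <- iota 0 n & j != nat_of_ord i]
        (fun zs => DBL_post_emp Pi p (map snd zs)
                     [seq nus n j | j <- iota 0 n & j != nat_of_ord i])) i).
have sumF : (\sum_(i < n) \int[kern theta0 (nus n i)]_z F z <=
    (n%:R * (alpha + eps + 2 * eps))%:E)%E.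
  apply: (@compound_level_le R _ (borel U) (fun i => kern theta0 (nus n i)) lam
    (fun i => condT (nus n i)) (fun i u => p u (nus n i)) _ _ _ n (alpha + eps) eps eta S C) => //.
  - by move=> i A A' mA mA'; exact: kern_condT.
  - by rewrite addr_ge0// ltW.
  - exact: ltW.
  - by move=> i; exact: UC.
rewrite muleC lee_pdivrMr//.
(* The sum over null units is enlarged to all units, each taken under [theta0], because the compound
   bound concerns the full mixture. *)
apply: (@le_trans _ _ (\sum_(i < n) (\int[kern theta0 (nus n i)]_z F z + eps%:E))%E).
  rewrite big_mkcond; apply: lee_sum => i _; case: ifPn => [/asboolP|_]; first exact: unit_le.
  by apply: adde_ge0; [exact: integral_ge0|rewrite lee_fin ltW].
rewrite big_split/=; apply: le_trans (leeD sumF (lexx _)) _.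
rewrite sumEFin sumr_const card_ord -!EFinD -EFinM lee_fin.
rewrite -[eps *+ n]mulr_natr [X in X + _]mulrC -mulrDl ler_pM2r//; lra.
Unshelve. all: by end_near. Qed.
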